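(* Let $G$ be a graph of order $n\ge5$. Then (1) $\mathcal E(G)\ge \omega(G)+\bar d(G)-1$, and (2) $\mathcal E(G)\ge 2\nu_{\rm ind}(G)+\bar d(G)-1$. (3) If $G$ has no isolated vertices, then $\mathcal E(G)\ge\gamma_t(G)+\bar d(G)-1$. (4) If $G$ is connected, then $\mathcal E(G)>\operatorname{diam}(G)+\bar d(G)-1$. Equality in the clique-number bound (1) holds exactly for complete graphs, whereas equality in either the induced-matching bound (2) or the total-domination bound (3) holds exactly for perfect matchings.
   Context: All graphs are finite and simple. For a graph $G$ with $n$ vertices (its order) and $m$ edges, let $\lambda_1\ge\cdots\ge\lambda_n$ be the eigenvalues of its adjacency matrix. The energy is $\mathcal E(G)=\sum_{i=1}^n|\lambda_i|$, and $\bar d(G)=2m/n$ is the average degree. The clique number $\omega(G)$ is the maximum order of a complete subgraph. The induced matching number $\nu_{\rm ind}(G)$ is the maximum size of a matching whose endpoints induce exactly the edges of the matching. For a graph without isolated vertices, the total domination number $\gamma_t(G)$ is the minimum cardinality of a set $S\subseteq V(G)$ such that every vertex of $G$ has a neighbor in $S$. For a connected graph, $\operatorname{diam}(G)$ denotes its diameter. The complete graph of order $n$ is $K_n$; a perfect matching here means the graph $\frac n2K_2$ with $n$ even, that is, the disjoint union of $n/2$ copies of $K_2$.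
   Formalization: Equality in the clique-number bound (1) is stated to hold exactly for complete graphs and edgeless graphs, since an edgeless graph has energy 0, clique number 1 and average degree 0 and so attains equality without being complete. *)

(* Defs.v *)
From mathcomp Require Import all_boot all_order all_algebra all_field.
Set Implicit Arguments.
Unset Strict Implicit.
Unset Printing Implicit Defensive.
Import GRing.Theory Num.Theory.
Local Open Scope ring_scope.

(* A finite simple graph is a symmetric irreflexive relation e on a finType T. *)

Definition adjacency (T : finType) (e : rel T) : 'M[algC]_#|T| :=
  \matrix_(i, j) (e (enum_val i) (enum_val j))%:R.

(* The roots of the characteristic polynomial, repeated according to
   multiplicity; the order in this list is irrelevant for the energy. *)
Definition eigenvalues (n : nat) (A : 'M[algC]_n) : seq algC :=
  sval (closed_field_poly_normal (char_poly A)).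

Definition energy (T : finType) (e : rel T) : algC :=
  \sum_(l <- eigenvalues (adjacency e)) `|l|.

Definition edges (T : finType) (e : rel T) : {set {set T}} :=
  [set [set p.1; p.2] | p : T * T & e p.1 p.2].

Definition average_degree (T : finType) (e : rel T) : algC :=
  (2 * #|edges e|)%:R / #|T|%:R.

Definition clique (T : finType) (e : rel T) (A : {set T}) : bool :=
  [forall x in A, forall y in A, (x != y) ==> e x y].

Definition clique_number (T : finType) (e : rel T) : nat :=
  \max_(A : {set T} | clique e A) #|A|.

Definition matching (T : finType) (e : rel T) (M : {set {set T}}) : bool :=
  (M \subset edges e) && trivIset M.

Definition induced_matching (T : finType) (e : rel T) (M : {set {set T}}) :
    bool :=
  matching e M && ([set f in edges e | f \subset cover M] == M).

Definition induced_matching_number (T : finType) (e : rel T) : nat :=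
  \max_(M : {set {set T}} | induced_matching e M) #|M|.

Definition no_isolated_vertex (T : finType) (e : rel T) : Prop :=
  forall x : T, exists y : T, e x y.

Definition total_dominating (T : finType) (e : rel T) (S : {set T}) : bool :=
  [forall x, exists y in S, e x y].

(* The default value #|T| bounds every term of the minimum, so it only matters
   when there is no total dominating set, i.e. when some vertex is isolated. *)
Definition total_domination_number (T : finType) (e : rel T) : nat :=
  \big[minn/#|T|]_(S : {set T} | total_dominating e S) #|S|.

Definition connected (T : finType) (e : rel T) : Prop :=
  forall x y : T, connect e x y.

(* Least length of a walk from x to y. Shortest walks repeat no vertex, so
   only lengths k < #|T| matter; the value is #|T| if y is unreachable. *)
Definition distance (T : finType) (e : rel T) (x y : T) : nat :=
  \big[minn/#|T|]_(k < #|T| |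
      [exists p : k.-tuple T, path e x p && (last x p == y)]) k.

Definition diameter (T : finType) (e : rel T) : nat :=
  \max_(p : T * T) distance e p.1 p.2.

Definition isomorphic (T1 T2 : finType) (e1 : rel T1) (e2 : rel T2) : Prop :=
  exists2 f : T1 -> T2, bijective f & forall x y, e2 (f x) (f y) = e1 x y.

Definition complete (n : nat) : rel 'I_n := [rel x y | x != y].

(* The disjoint union of k copies of the graph e. *)
Definition copies (k : nat) (T : finType) (e : rel T) : rel ('I_k * T) :=
  [rel x y | (x.1 == y.1) && e x.2 y.2].

Definition is_complete (T : finType) (e : rel T) : Prop :=
  isomorphic e (@complete #|T|).

Definition is_perfect_matching (T : finType) (e : rel T) : Prop :=
  ~~ odd #|T| /\ isomorphic e (@copies #|T|./2 _ (@complete 2)).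

(* Besides complete graphs, edgeless graphs attain the clique-number bound:
   energy 0, clique number 1, average degree 0. *)
Definition edgeless (T : finType) (e : rel T) : Prop :=
  forall x y : T, ~~ e x y.

(* Main.v *)
Require Import Defs.
From mathcomp Require Import all_boot all_order all_algebra all_field.
From mathcomp Require Import ring zify.
Set Implicit Arguments.
Unset Strict Implicit.
Unset Printing Implicit Defensive.
Import GRing.Theory Num.Theory Order.TTheory.
Local Open Scope ring_scope.
Local Open Scope sesquilinear_scope.

(** Write the adjacency matrix as [P^* diag(d) P], with [d i0] its largest
    eigenvalue; [d i0] is at least the average degree.

    If [S] and [R] have orthonormal columns and [M = S^* A R], then the operator
    [R (1 - z z^* ) S^*], with [z] the direction of the top eigenvector seen
    through [S], is a contraction killing that eigenvector.  Pairing it with [A]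
    bounds the sum of the [|d i|], [i <> i0], below by [tr M - z^* M z].

    When [A] contains a [k]-by-[k] identity submatrix this reads
    [E >= d i0 + k - 1].  A maximum induced matching gives [k = 2 nu] and the
    private neighbours of a minimum total dominating set give [k = gamma_t].
    Equality forces the other nonzero eigenvalues to be [1] or [-1], and then
    [tr A^2 = 2 m] forces [k = n].

    The clique bound is [E >= 2 (d i0)] combined with [d i0 >= omega - 1].  For
    the diameter [D >= 3], a geodesic is an induced path on [D + 1] vertices;
    its adjacency matrix has norm at most [2] and pairs with an orthogonal
    matrix to more than [D + 1].  For [D <= 2] the clique bound suffices. *)


(** * Contractions and diagonal entries *)
Section Isometries.
Variable C : numClosedFieldType.

Definition sqnorm (m : nat) (v : 'cV[C]_m) : C := \sum_i `|v i 0| ^+ 2.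

Lemma sqnormE m (v : 'cV[C]_m) : (v^t* *m v) 0 0 = sqnorm v.
Proof. by rewrite mxE; apply: eq_bigr => i _; rewrite !mxE mulrC normCK. Qed.

Lemma sqnorm_ge0 m (v : 'cV[C]_m) : 0 <= sqnorm v.
Proof. by apply: sumr_ge0 => i _; rewrite exprn_ge0. Qed.

Lemma sqnorm_eq0 m (v : 'cV[C]_m) : (sqnorm v == 0) = (v == 0).
Proof.
apply/eqP/eqP => [v0|->]; last first.
  by rewrite /sqnorm big1 // => i _; rewrite mxE normr0 expr0n.
apply/colP => i; rewrite mxE; apply/eqP; rewrite -normr_eq0 -sqrf_eq0.
by rewrite (psumr_eq0P _ v0) // => j _; rewrite exprn_ge0.
Qed.

Definition isometric m k (S : 'M[C]_(m, k)) : Prop := S^t* *m S = 1%:M.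

Lemma trmxC_mul m n p (A : 'M[C]_(m, n)) (B : 'M[C]_(n, p)) :
  (A *m B)^t* = B^t* *m A^t*.
Proof. by rewrite trmx_mul map_mxM. Qed.

Lemma trmxCB m n (A B : 'M[C]_(m, n)) : (A - B)^t* = A^t* - B^t*.
Proof. by apply/matrixP => i j; rewrite !mxE rmorphB. Qed.

Lemma trmxCZ m n a (A : 'M[C]_(m, n)) : (a *: A)^t* = a^* *: A^t*.
Proof. by apply/matrixP => i j; rewrite !mxE rmorphM. Qed.

Lemma isometry_sqnorm m k (S : 'M[C]_(m, k)) v :
  isometric S -> sqnorm (S *m v) = sqnorm v.
Proof. by move=> iS; rewrite -!sqnormE trmxC_mul -mulmxA (mulmxA (S^t*) S) iS mul1mx. Qed.

(** Pythagoras: [S *m S^t*] is the orthogonal projection onto the range of [S]. *)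
Lemma isometry_complement_sqnorm m k (S : 'M[C]_(m, k)) (v : 'cV_m) :
  isometric S ->
  sqnorm (v - S *m (S^t* *m v)) = sqnorm v - sqnorm (S^t* *m v).
Proof.
move=> iS; rewrite -!sqnormE !trmxC_mul trmxCK.
rewrite trmxCB !trmxC_mul trmxCK mulmxBl !mulmxBr.
have -> : v^t* *m S *m S^t* *m (S *m (S^t* *m v)) = v^t* *m S *m (S^t* *m v).
  by rewrite -!mulmxA (mulmxA (S^t*) S) iS mul1mx.
by rewrite !mulmxA subrr subr0 !mxE.
Qed.

Lemma coisometry_sqnorm m k (S : 'M[C]_(m, k)) (v : 'cV_m) :
  isometric S -> sqnorm (S^t* *m v) <= sqnorm v.
Proof.
by move=> iS; rewrite -subr_ge0 -isometry_complement_sqnorm // sqnorm_ge0.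
Qed.

(** When [x] vanishes any unit vector serves, which is where [0 < k] enters. *)
Lemma unit_direction k (x : 'cV[C]_k) : (0 < k)%N ->
  exists2 z : 'cV_k, sqnorm z = 1 & x = z *m (z^t* *m x).
Proof.
case: k x => // k x _; have [->|x0] := eqVneq x 0.
  exists (delta_mx 0 0); last by rewrite !mulmx0.
  rewrite /sqnorm (bigD1 0) //= big1 ?mxE ?eqxx ?normr1 ?expr1n ?addr0 //.
  by move=> i /negPf i0; rewrite mxE i0 /= normr0 expr0n.
have n0 : sqnorm x != 0 by rewrite sqnorm_eq0.
set s := sqrtC (sqnorm x); have s2 : s ^+ 2 = sqnorm x by rewrite sqrtCK.
have sge : 0 <= s by rewrite sqrtC_ge0 sqnorm_ge0.
have s0 : s != 0 by rewrite sqrtC_eq0.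
have cs : (s^-1)^* = s^-1 by apply: CrealP; rewrite realE invr_ge0 sge.
exists (s^-1 *: x).
  rewrite -sqnormE trmxCZ -scalemxAl -scalemxAr scalerA cs mxE sqnormE -s2.
  by field.
have -> : (s^-1 *: x)^t* *m x = (s^-1 * sqnorm x)%:M.
  by rewrite [LHS]mx11_scalar trmxCZ -scalemxAl mxE sqnormE cs.
by rewrite mul_mx_scalar scalerA -s2 (_ : _ * _ = 1) ?scale1r //; field.
Qed.

(* Compressing the diagonal operator [diag_mx d] to the ranges of [S] and [R]
   and deflating the direction [z] of [S^t* e_i0] gives a contraction [V] that
   kills [e_i0]; its diagonal is therefore a test vector for the sum of the
   [`|d 0 i|], [i != i0]. *)
Lemma deflated_witness n k (S R : 'M[C]_(n, k)) (d : 'rV[C]_n) (i0 : 'I_n)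
    (M := S^t* *m diag_mx d *m R) :
  (0 < k)%N -> isometric S -> isometric R ->
  exists (V : 'M_n) (z : 'cV_k),
    [/\ sqnorm z = 1, forall v, sqnorm (V *m v) <= sqnorm v, V i0 i0 = 0,
        \sum_i V i i * d 0 i = \tr M - (z^t* *m M *m z) 0 0
      & M = 1%:M -> V *m diag_mx d *m V = V].
Proof.
move=> k0 iS iR.
have [z z1 zx] := unit_direction (S^t* *m delta_mx i0 (0 : 'I_1)) k0.
have iz : isometric z.
  by rewrite /isometric [LHS]mx11_scalar sqnormE z1.
pose V := R *m (S^t* - z *m (z^t* *m S^t*)).
exists V, z; split => //.
- move=> v; rewrite /V -mulmxA isometry_sqnorm //.
  apply: le_trans (coisometry_sqnorm v iS); rewrite mulmxBl -!mulmxA.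
  by rewrite isometry_complement_sqnorm // gerBl sqnorm_ge0.
- have : V *m delta_mx i0 (0 : 'I_1) = 0.
    by rewrite /V -mulmxA mulmxBl -!mulmxA {1}zx subrr mulmx0.
  by move/matrixP/(_ i0 0); rewrite -colE !mxE.
- have -> : \sum_i V i i * d 0 i = \tr (V *m diag_mx d).
    by apply: eq_bigr => i _; rewrite mul_mx_diag !mxE.
  rewrite /V -mulmxA mxtrace_mulC mulmxBl mulmxBl linearB /= -!mulmxA.
  rewrite (mxtrace_mulC z) -!mulmxA /M [X in _ - X = _]trace_mx11.
  by rewrite !mulmxA.
(* With [M] the identity, [X *m (diag_mx d *m R)] is the projection off [z]; it fixes [X], whose
   range is already orthogonal to [z]. *)
- move=> M1; pose X := S^t* - z *m (z^t* *m S^t*).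
  have XDR : X *m (diag_mx d *m R) = 1%:M - z *m z^t*.
    by rewrite mulmxBl -!mulmxA !(mulmxA (S^t*)) -/M M1 mulmx1.
  rewrite /V -/X -!mulmxA (mulmxA _ R) (mulmxA X) XDR; congr (R *m _).
  rewrite mulmxBl mul1mx -mulmxA mulmxBr (mulmxA (z^t*) z) iz mul1mx subrr.
  by rewrite mulmx0 subr0.
Qed.

Lemma sqnorm_delta n (i : 'I_n) : sqnorm (delta_mx i 0 : 'cV[C]_n) = 1.
Proof.
rewrite /sqnorm (bigD1 i) //= big1 ?mxE ?eqxx ?normr1 ?expr1n ?addr0 //.
by move=> j /negPf ij; rewrite mxE ij /= normr0 expr0n.
Qed.

Lemma contraction_col n (V : 'M[C]_n) i :
  (forall v, sqnorm (V *m v) <= sqnorm v) -> \sum_j `|V j i| ^+ 2 <= 1.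
Proof.
move=> cV; have := cV (delta_mx i 0); rewrite sqnorm_delta.
by rewrite -colE /sqnorm; under eq_bigr do rewrite mxE.
Qed.

Lemma contraction_diag n (V : 'M[C]_n) i :
  (forall v, sqnorm (V *m v) <= sqnorm v) -> `|V i i| <= 1.
Proof.
move=> /(contraction_col i); rewrite (bigD1 i) //= => cV.
rewrite -(@expr_le1 _ 2) // (le_trans _ cV) // lerDl sumr_ge0 // => j _.
by rewrite exprn_ge0.
Qed.

(** Diagonal entries of a contraction have modulus at most 1, and the one at [i0] vanishes. *)
Lemma deflated_bound n k (S R : 'M[C]_(n, k)) (d : 'rV[C]_n) (i0 : 'I_n)
    (M := S^t* *m diag_mx d *m R) :
  (0 < k)%N -> isometric S -> isometric R ->
  exists2 z : 'cV_k, sqnorm z = 1 &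
    `|\tr M| <= `|(z^t* *m M *m z) 0 0| + \sum_(i | i != i0) `|d 0 i|.
Proof.
move=> k0 iS iR.
have [V [z [z1 cV V0 trV _]]] := deflated_witness d i0 k0 iS iR.
exists z => //; rewrite -/M in trV.
have -> : \tr M = (z^t* *m M *m z) 0 0 + \sum_(i | i != i0) V i i * d 0 i.
  by move: trV; rewrite (bigD1 i0) //= V0 mul0r add0r => ->; rewrite addrC subrK.
apply: le_trans (ler_normD _ _) _; rewrite lerD2l.
apply: le_trans (ler_norm_sum _ _ _) _; apply: ler_sum => i _.
by rewrite normrM ler_piMl // contraction_diag.
Qed.

Lemma isometric_pairing n k (S R : 'M[C]_(n, k)) (d : 'rV[C]_n) (i0 : 'I_n) :
  (0 < k)%N -> isometric S -> isometric R -> S^t* *m diag_mx d *m R = 1%:M ->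
  k%:R - 1 <= \sum_(i | i != i0) `|d 0 i|.
Proof.
move=> k0 iS iR M1; have [z z1] := deflated_bound d i0 k0 iS iR.
by rewrite M1 mulmx1 sqnormE z1 mxtrace1 normr1 normr_nat -lerBlDl.
Qed.

(* In the equality case the contraction [V] of [deflated_witness] acts as the
   sign of [d], and [V D V = V] forces the nonzero entries to be [1] or [-1]. *)
Lemma isometric_pairing_eq n k (S R : 'M[C]_(n, k)) (d : 'rV[C]_n) (i0 : 'I_n) :
  (0 < k)%N -> isometric S -> isometric R -> S^t* *m diag_mx d *m R = 1%:M ->
  \sum_(i | i != i0) `|d 0 i| = k%:R - 1 ->
  \sum_(i | i != i0) `|d 0 i| ^+ 2 = k%:R - 1.
Proof.
move=> k0 iS iR M1 sum_d.
have [V [z [z1 cV V0 trV VDV]]] := deflated_witness d i0 k0 iS iR.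
have {}VDV := VDV M1.
have Vd i : i != i0 -> V i i * d 0 i = `|d 0 i|.
  have Vd_le j : j != i0 -> `|V j j * d 0 j| <= `|d 0 j|.
    by move=> _; rewrite normrM ler_piMl // contraction_diag.
  apply: (normC_sum_upper Vd_le).
  rewrite sum_d; move: trV; rewrite (bigD1 i0) //= V0 mul0r add0r => ->.
  by rewrite M1 mulmx1 sqnormE z1 mxtrace1.
rewrite -sum_d; apply: eq_bigr => i /Vd Vdi.
have [->|d0] := eqVneq (d 0 i) 0; first by rewrite normr0 expr0n.
have Vii : `|V i i| = 1.
  by apply: (mulIf (_ : `|d 0 i| != 0)); rewrite ?normr_eq0 // mul1r -normrM Vdi normr_id.
(* A column of a contraction has norm at most 1, so a diagonal entry of modulus 1 leaves nothing for
   the rest of its column. *)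
have Vji j : j != i -> V j i = 0.
  move=> ji; apply/eqP; rewrite -normr_eq0 -sqrf_eq0; apply/eqP.
  have := contraction_col i cV; rewrite (bigD1 i) //= Vii expr1n gerDl => sle.
  have s0 : \sum_(j | j != i) `|V j i| ^+ 2 = 0.
    by apply/eqP; rewrite eq_le sle sumr_ge0 // => l _; rewrite exprn_ge0.
  by apply: (psumr_eq0P _ s0) => // l _; rewrite exprn_ge0.
have /matrixP/(_ i i) := VDV; rewrite mxE (bigD1 i) //= big1 => [|j ji]; last first.
  by rewrite Vji ?mulr0.
rewrite addr0 mul_mx_diag mxE Vdi => VV.
have Vn0 : V i i != 0 by rewrite -normr_eq0 Vii oner_eq0.
have d1 : `|d 0 i| = 1 by apply: (mulIf Vn0); rewrite VV mul1r.
by rewrite d1 expr1n.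
Qed.
End Isometries.

(** * Spectral decomposition of real symmetric matrices *)

Section Diagonalization.
Variable n : nat.
Implicit Types (A P : 'M[algC]_n) (d : 'rV[algC]_n).

Definition diagonalizes A P d : Prop :=
  [/\ P *m P^t* = 1%:M, forall i, d 0 i \is Num.real
    & A = P^t* *m diag_mx d *m P].

Lemma diagonalizes_exists A :
  A \is symmetricmx -> A \is a realmx -> exists P d, diagonalizes A P d.
Proof.
move=> As Ar; exists (spectralmx A), (spectral_diag A).
have PU := spectral_unitarymx A.
split; first exact/unitarymxP.
  by apply/mxOverP/hermitian_spectral_diag_real/realsym_hermsym.
by rewrite -invmx_unitary //; apply/orthomx_spectralP/symmetric_normalmx.
Qed.

Variables (A P : 'M[algC]_n) (d : 'rV[algC]_n).
Hypothesis dgA : diagonalizes A P d.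

Lemma diagonalizes_isometry : isometric P.
Proof. by have [PP _ _] := dgA; apply: mulmx1C. Qed.

Lemma diagonalizes_conj : P *m A *m P^t* = diag_mx d.
Proof.
have [PP _ ->] := dgA.
by rewrite -!mulmxA PP mulmx1 !mulmxA PP mul1mx.
Qed.

(** The energy is defined from the roots of the characteristic polynomial; unitary similarity,
    lifted to polynomial matrices, identifies them with the entries of [d]. *)
Lemma diagonalizes_char_poly : char_poly A = \prod_i ('X - (d 0 i)%:P).
Proof.
have [PP _ defA] := dgA; have PP' := diagonalizes_isometry.
have -> : \prod_i ('X - (d 0 i)%:P) = char_poly (diag_mx d).
  rewrite char_poly_trig ?diag_mx_is_trig //.
  by apply: eq_bigr => i _; rewrite mxE eqxx.
pose Q := map_mx (@polyC algC) P; pose Q' := map_mx (@polyC algC) (P^t*).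
have Q'Q : Q' *m Q = 1%:M by rewrite -map_mxM PP' map_mx1.
rewrite /char_poly /char_poly_mx.
have -> : 'X%:M - map_mx polyC A = Q' *m ('X%:M - map_mx polyC (diag_mx d)) *m Q.
  rewrite mulmxBr mulmxBl mul_mx_scalar -scalemxAl Q'Q scalemx1.
  by rewrite -!map_mxM -defA.
by rewrite !det_mulmx mulrC mulrA -det_mulmx mulmx1C // det1 mul1r.
Qed.

Lemma diagonalizes_sum_norm : \sum_(l <- eigenvalues A) `|l| = \sum_i `|d 0 i|.
Proof.
rewrite -[RHS](big_map (fun i => d 0 i) xpredT (fun l => `|l|)).
apply: perm_big; apply: prod_XsubC_eq; rewrite big_map /=.
rewrite -diagonalizes_char_poly /eigenvalues.
case: closed_field_poly_normal => s /= defA.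
by rewrite [RHS]defA (monicP (char_poly_monic A)) scale1r.
Qed.

Lemma diagonalizes_trace : \sum_i d 0 i = \tr A.
Proof.
have [PP _ ->] := dgA.
rewrite mxtrace_mulC mulmxA PP mul1mx.
by apply: eq_bigr => i _; rewrite mxE eqxx.
Qed.

Lemma diagonalizes_sqr : diag_mx d *m diag_mx d = P *m (A *m A) *m P^t*.
Proof.
rewrite -diagonalizes_conj -!mulmxA (mulmxA (P^t*) P).
by rewrite diagonalizes_isometry mul1mx.
Qed.

Lemma diagonalizes_trace_sqr : \sum_i `|d 0 i| ^+ 2 = \tr (A *m A).
Proof.
have [_ rd _] := dgA; rewrite -[A *m A]mul1mx -diagonalizes_isometry.
rewrite -!mulmxA mxtrace_mulC -diagonalizes_sqr.
apply: eq_bigr => i _; rewrite mulmx_diag !mxE eqxx.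
by rewrite real_normK // expr2.
Qed.

(** Restricts the eigenvalues without exhibiting eigenvectors; used for complete graphs and perfect
    matchings. *)
Lemma diagonalizes_quadratic_relation a b i :
  A *m A = a *: A + b%:M -> d 0 i ^+ 2 = a * d 0 i + b.
Proof.
have [PP _ _] := dgA; move=> AA; have := diagonalizes_sqr.
rewrite AA mulmxDr mulmxDl -scalemxAr -scalemxAl diagonalizes_conj.
rewrite mul_mx_scalar -scalemxAl PP => /matrixP/(_ i i).
by rewrite mulmx_diag !mxE eqxx mulr1 expr2.
Qed.

Lemma diagonalizes_compression k (S R : 'M_(n, k)) :
  (P *m S)^t* *m diag_mx d *m (P *m R) = S^t* *m A *m R.
Proof.
rewrite trmxC_mul -diagonalizes_conj -!mulmxA !(mulmxA (P^t*) P).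
by rewrite diagonalizes_isometry !mul1mx.
Qed.

Lemma diagonalizes_quadratic_form (v : 'cV_n) :
  (v^t* *m A *m v) 0 0 = \sum_i d 0 i * `|(P *m v) i 0| ^+ 2.
Proof.
rewrite -diagonalizes_compression mxE; apply: eq_bigr => i _.
by rewrite mul_mx_diag !mxE normCK mulrA [_ * d 0 i]mulrC mulrAC.
Qed.

Lemma exists_top (k : 'I_n) : exists i0, forall i, d 0 i <= d 0 i0.
Proof.
have [_ rd _] := dgA.
have rF : {in xpredT, forall i, d 0 i \is Num.real} by move=> i _; apply: rd.
have [i0 _ mx] := real_arg_maxP (isT : xpredT k) rF.
by exists i0 => i; apply: mx.
Qed.

Lemma rayleigh i0 (v : 'cV_n) : (forall i, d 0 i <= d 0 i0) ->
  (v^t* *m A *m v) 0 0 <= d 0 i0 * sqnorm v.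
Proof.
move=> top; rewrite diagonalizes_quadratic_form.
rewrite -(isometry_sqnorm v diagonalizes_isometry) mulr_sumr.
by apply: ler_sum => i _; rewrite ler_wpM2r // exprn_ge0.
Qed.

(** Equality makes the nonnegative terms (d_i0 - d_i)|(Pv)_i|^2 sum to zero, and the first factor is
    positive for [i != i0]. *)
Lemma rayleigh_eq i0 (v : 'cV_n) : 0 < d 0 i0 ->
  (forall i, i != i0 -> d 0 i <= 0) ->
  (v^t* *m A *m v) 0 0 = d 0 i0 * sqnorm v ->
  forall i, i != i0 -> (P *m v) i 0 = 0.
Proof.
move=> d0 dn; rewrite diagonalizes_quadratic_form.
rewrite -(isometry_sqnorm v diagonalizes_isometry) mulr_sumr => /esym/eqP.
rewrite -subr_eq0 -sumrB (bigD1 i0) //= subrr add0r => /eqP s0 i ii0.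
have ge0 : forall i, i != i0 -> 0 <=
    d 0 i0 * `|(P *m v) i 0| ^+ 2 - d 0 i * `|(P *m v) i 0| ^+ 2.
  move=> j ji0; rewrite -mulrBl mulr_ge0 ?exprn_ge0 // subr_ge0.
  by rewrite (le_trans (dn j ji0)) // ltW.
have /eqP := psumr_eq0P ge0 s0 ii0.
rewrite -mulrBl mulf_eq0 sqrf_eq0 normr_eq0.
case/orP => /eqP // /eqP; rewrite subr_eq0 => /eqP di.
rewrite di in d0; by have := lt_le_trans d0 (dn i ii0); rewrite ltxx.
Qed.

(** A negative largest eigenvalue would make the trace negative. *)
Lemma top_norm i0 : (forall i, d 0 i <= d 0 i0) -> \tr A = 0 -> `|d 0 i0| = d 0 i0.
Proof.
have [_ rd _] := dgA; move=> top trA; apply: ger0_norm.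
have [//|dneg] := real_ge0P (rd i0).
have /eqP : \sum_i d 0 i = 0 by rewrite diagonalizes_trace.
rewrite lt_eqF // (bigD1 i0) //= ltr_wnDr // sumr_le0 // => i _.
by rewrite (le_trans (top i)) // ltW.
Qed.

(* The trace vanishes, so the other eigenvalues add up to [- d 0 i0]. *)
Lemma twice_top_bound i0 :
  (forall i, d 0 i <= d 0 i0) -> \tr A = 0 -> 2 * d 0 i0 <= \sum_i `|d 0 i|.
Proof.
move=> top trA; rewrite (bigD1 i0) //= top_norm // mulr2n mulrDl mul1r lerD2l.
have : \sum_i d 0 i = 0 by rewrite diagonalizes_trace.
rewrite (bigD1 i0) //= => /eqP; rewrite addr_eq0 => /eqP s.
by rewrite -{1}(top_norm top trA) s normrN ler_norm_sum.
Qed.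

(** Equality in the triangle inequality for the sum of the [- d 0 i], [i != i0], makes each of them
    equal to its absolute value. *)
Lemma twice_top_eq i0 :
  (forall i, d 0 i <= d 0 i0) -> \tr A = 0 -> \sum_i `|d 0 i| = 2 * d 0 i0 ->
  forall i, i != i0 -> d 0 i <= 0.
Proof.
move=> top trA; rewrite (bigD1 i0) //= top_norm // mulr2n mulrDl mul1r.
move=> /addrI sn.
have : \sum_i d 0 i = 0 by rewrite diagonalizes_trace.
rewrite (bigD1 i0) //= => /eqP; rewrite addrC addr_eq0 -sn => /eqP s i ii0.
have : - d 0 i = `|d 0 i|.
  have le j : j != i0 -> `|- d 0 j| <= `|d 0 j| by rewrite normrN.
  by apply: (normC_sum_upper le) ii0; rewrite sumrN s opprK.
by move=> Nd; rewrite -oppr_ge0 Nd.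
Qed.

End Diagonalization.

(** * Adjacency matrices and pairings *)

Lemma addr_eq_le (R : numDomainType) (a b x y : R) :
  a <= x -> b <= y -> x + y = a + b -> x = a /\ y = b.
Proof.
move=> ax by_ xy.
have xa : x = a by apply/le_anti; rewrite ax andbT -(lerD2r y) xy lerD2l.
by split=> //; move: xy; rewrite xa => /addrI.
Qed.

Lemma isometric_mul m1 m2 m3 (X : 'M[algC]_(m1, m2)) (Y : 'M_(m2, m3)) :
  isometric X -> isometric Y -> isometric (X *m Y).
Proof.
move=> iX iY; rewrite /isometric trmxC_mul -mulmxA (mulmxA (X^t*)) iX.
by rewrite mul1mx.
Qed.

Definition selection_mx k n (f : 'I_k -> 'I_n) : 'M[algC]_(n, k) :=
  colsub f 1%:M.

Lemma selection_compression k n (f g : 'I_k -> 'I_n) B :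
  (selection_mx f)^t* *m B *m selection_mx g = mxsub f g B.
Proof.
rewrite mulmx_colsub mulmx1 /selection_mx trmx_mxsub map_mxsub trmx1 map_mx1.
by rewrite mul_rowsub_mx mul1mx; apply/matrixP => i j; rewrite !mxE.
Qed.

Lemma selection_isometric k n (f : 'I_k -> 'I_n) :
  injective f -> isometric (selection_mx f).
Proof.
move=> f_inj; rewrite /isometric -[X in X *m _]mulmx1 selection_compression.
by apply/matrixP => i j; rewrite !mxE (inj_eq f_inj).
Qed.

Section Adjacency.
Variables (T : finType) (e : rel T).
Hypotheses (e_sym : symmetric e) (e_irr : irreflexive e).
Let A := adjacency e.

Lemma sum_enum_val (F : T -> algC) :
  \sum_(i < #|T|) F (enum_val i) = \sum_x F x.
Proof.
rewrite [RHS](reindex_onto enum_val enum_rank) /= => [|x _]; last exact: enum_rankK.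
by apply: eq_bigl => i; rewrite enum_valK eqxx.
Qed.

Lemma adjacency_diagonalizes : exists P d, diagonalizes A P d.
Proof.
apply: diagonalizes_exists.
  apply/is_hermitianmxP; rewrite scale1r map_mx_id //.
  by apply/matrixP => i j; rewrite !mxE e_sym.
by apply/mxOverP => i j; rewrite mxE realn.
Qed.

Lemma adjacency_trace : \tr A = 0.
Proof. by rewrite /mxtrace big1 // => i _; rewrite mxE e_irr. Qed.

(** Arcs are grouped by their underlying edge; each fibre consists of the two arcs [(x, y)] and
    [(y, x)]. *)
Lemma sum_arcs : (\sum_x \sum_y e x y = 2 * #|edges e|)%N.
Proof.
pose arcs := [pred p : T * T | e p.1 p.2].
pose h (p : T * T) := [set p.1; p.2].
rewrite pair_big /= -big_mkcond /= sum1_card -/arcs.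
rewrite -sum1_card (partition_big h [in edges e]) /=; last first.
  by move=> p ep; apply/imsetP; exists p => //; rewrite inE.
rewrite [LHS](eq_bigr (fun=> 2%N)) => [|f]; first by rewrite sum_nat_const mulnC.
move=> /imsetP[[x y] /=]; rewrite inE /= => exy ->.
have xy : x != y by apply: contraTneq exy => ->; rewrite e_irr.
rewrite sum1_card.
have -> : 2%N = #|[set (x, y); (y, x)]|.
  by rewrite cards2 xpair_eqE negb_and xy.
apply: eq_card => -[a b]; rewrite !inE /h /= !xpair_eqE.
apply/andP/orP => [[eab /eqP E]|[]/andP[/eqP-> /eqP->]]; last 2 first.
- by split.
- by split; [have : e y x by rewrite e_sym | rewrite /= setUC].
have {}eab : e a b := eab; have ab : a != b by apply: contraTneq eab => ->; rewrite e_irr.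
have /set2P[] : a \in [set x; y] by rewrite -E set21.
  move=> ax; left; rewrite ax eqxx /=.
  by have /set2P[bx|->//] : b \in [set x; y]; [rewrite -E set22|rewrite ax bx eqxx in ab].
move=> ay; right; rewrite ay eqxx /=.
by have /set2P[->//|bY] : b \in [set x; y]; [rewrite -E set22|rewrite ay bY eqxx in ab].
Qed.

Lemma adjacency_trace_sqr : \tr (A *m A) = (2 * #|edges e|)%:R.
Proof.
rewrite -sum_arcs natr_sum -sum_enum_val.
apply: eq_bigr => i _; rewrite mxE natr_sum -sum_enum_val.
apply: eq_bigr => j _; rewrite !mxE (e_sym (enum_val j)).
by case: e; rewrite ?mulr1 ?mulr0.
Qed.

Definition indicator (K : {set T}) : 'cV[algC]_#|T| :=
  \col_i (enum_val i \in K)%:R.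

Lemma indicator_sqnorm K : sqnorm (indicator K) = #|K|%:R.
Proof.
rewrite -[#|K|]sum1_card natr_sum [RHS]big_mkcond -sum_enum_val.
apply: eq_bigr => i _; rewrite mxE.
by case: (_ \in K); rewrite ?normr1 ?normr0 ?expr1n ?expr0n.
Qed.

Lemma indicator_trmxC K : (indicator K)^t* = (indicator K)^T.
Proof. by apply/matrixP => i j; rewrite !mxE conjC_nat. Qed.

Lemma indicator_form K :
  ((indicator K)^t* *m A *m indicator K) 0 0 =
  (\sum_(x in K) \sum_(y in K) e x y)%:R.
Proof.
rewrite indicator_trmxC -mulmxA mxE natr_sum [RHS]big_mkcond -sum_enum_val.
apply: eq_bigr => i _; rewrite !mxE.
case: (_ \in K); last by rewrite mul0r.
rewrite mul1r natr_sum [RHS]big_mkcond -sum_enum_val.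
by apply: eq_bigr => j _; rewrite !mxE; case: (_ \in K); rewrite ?mulr1 ?mulr0.
Qed.

Lemma average_degreeE : (0 < #|T|)%N ->
  average_degree e * #|T|%:R = (2 * #|edges e|)%:R.
Proof. by move=> T0; rewrite /average_degree divfK // pnatr_eq0 -lt0n. Qed.

Lemma average_degree_le : (0 < #|T|)%N -> average_degree e <= #|T|%:R - 1.
Proof.
move=> T0; rewrite -(@ler_pM2r _ #|T|%:R) ?ltr0n // average_degreeE //.
rewrite -(natrB _ T0) -natrM ler_nat -sum_arcs subn1.
rewrite mulnC -sum_nat_const; apply: leq_sum => x _.
rewrite -(cardC1 x) -sum1_card [leqRHS]big_mkcond.
apply: leq_sum => y _; rewrite !inE; case: eqP => [->|_]; first by rewrite e_irr.
by case: e.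
Qed.

Variables (P : 'M[algC]_#|T|) (d : 'rV[algC]_#|T|) (i0 : 'I_#|T|).
Hypotheses (dgA : diagonalizes A P d) (top : forall i, d 0 i <= d 0 i0).

Lemma energyE : energy e = \sum_i `|d 0 i|.
Proof. exact: diagonalizes_sum_norm dgA. Qed.

(** This is the Rayleigh quotient of the all-ones vector. *)
Lemma top_ge_average : average_degree e <= d 0 i0.
Proof.
have T0 : (0 < #|T|)%N by case: (#|T|) i0 => // -[].
have := rayleigh dgA (indicator setT) top.
rewrite indicator_sqnorm cardsT indicator_form.
rewrite /average_degree ler_pdivrMr ?ltr0n // -sum_arcs.
rewrite (eq_bigl xpredT) => [|x]; last by rewrite inE.
by under eq_bigr do (rewrite (eq_bigl xpredT) => [|y]; last by rewrite inE).
Qed.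

Lemma edge_clique x y : e x y -> clique e [set x; y] /\ #|[set x; y]| = 2%N.
Proof.
move=> exy; have xy : x != y by apply: contraTneq exy => ->; rewrite e_irr.
split; last by rewrite cards2 xy.
apply/forall_inP => a /set2P[]->; apply/forall_inP => b /set2P[]->;
  rewrite ?eqxx ?exy ?implybT //.
by rewrite e_sym exy implybT.
Qed.

Lemma clique_form K : clique e K ->
  (\sum_(x in K) \sum_(y in K) e x y = #|K| * #|K|.-1)%N.
Proof.
move=> /forall_inP cK; rewrite -sum_nat_const; apply: eq_bigr => x xK.
rewrite (cardsD1 x K) xK /= -sum1_card (bigD1 x) //= e_irr add0n.
rewrite big_mkcond [RHS]big_mkcond; apply: eq_bigr => y _; rewrite !inE andbC.
case: (eqVneq y x) => //= yx; case: ifP => // yK.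
by have /forall_inP/(_ y yK) := cK x xK; rewrite eq_sym yx /= => ->.
Qed.

Lemma clique_rayleigh K : clique e K ->
  ((indicator K)^t* *m A *m indicator K) 0 0 =
  (#|K|%:R - 1) * sqnorm (indicator K).
Proof.
move=> cK; rewrite indicator_form clique_form // indicator_sqnorm natrM mulrC.
have [->|K0] := posnP #|K|; first by rewrite !mulr0.
by rewrite -subn1 natrB.
Qed.

Lemma top_ge_clique K : K != set0 -> clique e K -> #|K|%:R - 1 <= d 0 i0.
Proof.
move=> K0 /clique_rayleigh qK; have := rayleigh dgA (indicator K) top.
by rewrite qK ler_pM2r // indicator_sqnorm ltr0n card_gt0.
Qed.

Lemma top_ge1 x y : e x y -> 1 <= d 0 i0.
Proof.
case/edge_clique => cxy card2.
have <- : #|[set x; y]|%:R - 1 = 1 :> algC by rewrite card2 -[2%N]addn1 natrD addrK.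
by apply: top_ge_clique => //; apply/set0Pn; exists x; rewrite set21.
Qed.

Section Pairing.
Variables (C : {set T}) (r : T -> T).
(** The rows indexed by [C] and the columns indexed by the images [r y] form an identity submatrix
    of the adjacency matrix. *)
Hypothesis r_pairing : {in C &, forall x y, e x (r y) = (x == y)}.

Let k := #|C|.
Let sel (g : T -> T) (s : 'I_k) : 'I_#|T| := enum_rank (g (enum_val s)).
Let emb (g : T -> T) := selection_mx (sel g).

Lemma pairing_inj : {in C &, injective r}.
Proof.
move=> x y xC yC rxy; apply/eqP; rewrite -r_pairing // -rxy.
by rewrite r_pairing // eqxx.
Qed.

Lemma pairing_compression :
  (P *m emb id)^t* *m diag_mx d *m (P *m emb r) = 1%:M.
Proof.
rewrite (diagonalizes_compression dgA) selection_compression.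
apply/matrixP => i j; rewrite !mxE !enum_rankK r_pairing ?enum_valP //.
by rewrite (inj_eq enum_val_inj).
Qed.

Lemma pairing_isometric g : {in C &, injective g} -> isometric (P *m emb g).
Proof.
move=> g_inj; apply: isometric_mul; first exact: diagonalizes_isometry dgA.
apply: selection_isometric => i j /enum_rank_inj /g_inj ij.
by apply: enum_val_inj; apply: ij; apply: enum_valP.
Qed.

Lemma energy_split : energy e = d 0 i0 + \sum_(i | i != i0) `|d 0 i|.
Proof.
by rewrite energyE (bigD1 i0) //= (top_norm dgA top adjacency_trace).
Qed.

Lemma pairing_bound : #|C|%:R + average_degree e - 1 <= energy e.
Proof.
(* Deflation needs a nonempty [C]; for the empty one the top eigenvalue alone exceeds the bound. *)
have [C0|C0] := posnP #|C|.
  rewrite C0 add0r (@le_trans _ _ (d 0 i0)) ?energy_split //.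
    by rewrite (le_trans _ top_ge_average) // gerBl.
  by rewrite lerDl sumr_ge0.
rewrite energy_split addrAC [leRHS]addrC; apply: lerD top_ge_average.
apply: isometric_pairing pairing_compression => //; apply: pairing_isometric.
  exact: in2W.
exact: pairing_inj.
Qed.

(* Equality forces [sum d_i^2 = a^2 + #|C| - 1] with [a] the average degree;
   the left side is [a #|T|], and [a #|T| - a^2 >= #|T| - 1] because
   [1 <= a <= #|T| - 1]. *)
Lemma pairing_eq : energy e = #|C|%:R + average_degree e - 1 ->
  #|C| = #|T|.
Proof.
move=> En; have T0 : (0 < #|T|)%N by case: (#|T|) i0 => // -[].
have avg_top := top_ge_average.
have [C0|C0] := posnP #|C|.
  have : d 0 i0 <= energy e by rewrite energy_split lerDl sumr_ge0.
  rewrite En C0 add0r => /(le_trans avg_top); rewrite -subr_ge0.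
  by rewrite addrC addKr oppr_ge0 ler10.
have iS : isometric (P *m emb id) by apply: pairing_isometric; apply: in2W.
have iR : isometric (P *m emb r) by apply: pairing_isometric pairing_inj.
have lb := isometric_pairing i0 C0 iS iR pairing_compression.
have sq := isometric_pairing_eq C0 iS iR pairing_compression.
have En' : energy e = average_degree e + (#|C|%:R - 1) by rewrite En; ring.
rewrite energy_split in En'.
have [d0 /sq {}sq] := addr_eq_le avg_top lb En'.
have /card_gt0P[x xC] := C0.
have := top_ge1 (x := x) (y := r x); rewrite r_pairing // eqxx => /(_ isT) a1.
have an := average_degree_le T0.
have := diagonalizes_trace_sqr dgA; rewrite adjacency_trace_sqr -average_degreeE //.
rewrite (bigD1 i0) //= sq (top_norm dgA top adjacency_trace) d0 => tr2.
rewrite d0 in a1; apply/eqP; rewrite eqn_leq max_card /= -(ler_nat algC).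
have : 0 <= (average_degree e - 1) * (#|T|%:R - 1 - average_degree e).
  by rewrite mulr_ge0 // subr_ge0.
have -> : (average_degree e - 1) * (#|T|%:R - 1 - average_degree e) =
  average_degree e * #|T|%:R - average_degree e ^+ 2 - #|T|%:R + 1 by ring.
rewrite -tr2 (_ : _ + 1 = #|C|%:R - #|T|%:R); last by ring.
by rewrite subr_ge0.
Qed.

End Pairing.
End Adjacency.

(** * Energy bounds from pairings and from cliques *)

Section EnergyBounds.
Variables (T : finType) (e : rel T).
Hypotheses (e_sym : symmetric e) (e_irr : irreflexive e) (T0 : (0 < #|T|)%N).

Lemma spectrum_exists : exists (P : 'M[algC]_#|T|) d (i0 : 'I_#|T|),
  diagonalizes (adjacency e) P d /\ forall i, d 0 i <= d 0 i0.
Proof.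
have [P [d dg]] := adjacency_diagonalizes e_sym.
have [i0 top] := exists_top dg (Ordinal T0).
by exists P, d, i0.
Qed.

Lemma energy_pairing_bound (C : {set T}) (r : T -> T) :
  {in C &, forall x y, e x (r y) = (x == y)} ->
  #|C|%:R + average_degree e - 1 <= energy e.
Proof.
move=> rC; have [P [d [i0 [dg top]]]] := spectrum_exists.
exact: (pairing_bound e_sym e_irr dg top rC).
Qed.

(** Equality makes [C] the whole vertex set; [r] is then a bijection and [r x] is the only neighbour
    of [x]. *)
Lemma energy_pairing_eq (C : {set T}) (r : T -> T) :
  {in C &, forall x y, e x (r y) = (x == y)} ->
  energy e = #|C|%:R + average_degree e - 1 ->
  exists m : T -> T, forall x y, e x y = (y == m x).
Proof.
move=> rC En; have [P [d [i0 [dg top]]]] := spectrum_exists.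
have CT : C = setT.
  apply/eqP; rewrite eqEcard subsetT cardsT.
  by rewrite (pairing_eq e_sym e_irr dg top rC En) leqnn.
rewrite {}CT in rC *.
have r_inj : injective r by move=> x y; apply: (pairing_inj rC); rewrite inE.
have [r' rK r'K] := injF_bij r_inj.
exists r => x y; rewrite -(r'K y) rC ?inE //.
by rewrite (inj_eq r_inj) eq_sym.
Qed.

Lemma clique_attained :
  exists2 K : {set T}, clique e K & #|K| = clique_number e.
Proof.
have [|K cK maxK] := @eq_bigmax_cond _ [pred K | clique e K] (fun K => #|K|).
  apply/card_gt0P; exists set0; rewrite inE.
  by apply/forall_inP => x; rewrite inE.
by exists K; [rewrite inE in cK | rewrite -maxK].
Qed.

Lemma leq_clique_number K : clique e K -> (#|K| <= clique_number e)%N.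
Proof. exact: (leq_bigmax_cond (F := fun K : {set T} => #|K|)). Qed.

Lemma clique_number_gt0 : (0 < clique_number e)%N.
Proof.
have /card_gt0P[x _] := T0; rewrite -(cards1 x); apply: leq_clique_number.
apply/forall_inP => y /set1P->; apply/forall_inP => z /set1P->.
by rewrite eqxx.
Qed.

Lemma clique_number_ge2 x y : e x y -> (2 <= clique_number e)%N.
Proof.
by case/(edge_clique e_sym e_irr) => /leq_clique_number cxy <-.
Qed.

(** One copy of the top eigenvalue is bounded below by the clique number minus one, the other by the
    average degree. *)
Lemma energy_clique_bound :
  (clique_number e)%:R + average_degree e - 1 <= energy e.
Proof.
have [P [d [i0 [dg top]]]] := spectrum_exists.
have [K cK cardK] := clique_attained.
rewrite (energyE dg); apply: le_trans (twice_top_bound dg top (adjacency_trace e_irr)).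
rewrite addrAC mulr2n mulrDl mul1r -cardK; apply: lerD; last first.
  exact: (top_ge_average e_sym e_irr dg top).
apply: (top_ge_clique e_irr dg top) => //; apply: contraTneq clique_number_gt0 => K0.
by rewrite -cardK K0 cards0.
Qed.

(* In the equality case the indicator of a maximum clique and the all-ones
   vector both lie in the one-dimensional top eigenspace. *)
Lemma energy_clique_eq :
  energy e = (clique_number e)%:R + average_degree e - 1 ->
  (forall x y, e x y = (x != y)) \/ edgeless e.
Proof.
move=> En; have [P [d [i0 [dg top]]]] := spectrum_exists.
have [K cK cardK] := clique_attained.
have tr0 := adjacency_trace e_irr.
have K0 : K != set0.
  apply: contraTneq clique_number_gt0 => K0.
  by rewrite -cardK K0 cards0.
have topK := top_ge_clique e_irr dg top K0 cK.
have topA := top_ge_average e_sym e_irr dg top.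
have topE := twice_top_bound dg top tr0.
rewrite -(energyE dg) in topE.
have E2 : 2 * d 0 i0 = energy e.
  apply/le_anti; rewrite topE En addrAC -cardK mulr2n mulrDl mul1r.
  exact: lerD.
have [dK dA] : d 0 i0 = #|K|%:R - 1 /\ d 0 i0 = average_degree e.
  apply: addr_eq_le => //; move: E2; rewrite mulr2n mulrDl mul1r => ->.
  by rewrite En -cardK addrAC.
have [/existsP[x /existsP[y exy]]|/existsPn noe] := boolP [exists x, exists y, e x y];
  last by right=> x y; have /existsPn/(_ y) := noe x.
left.
have d_gt0 : 0 < d 0 i0 by apply: lt_le_trans ltr01 (top_ge1 e_sym e_irr dg top exy).
have neg i : i != i0 -> d 0 i <= 0.
  by apply: (twice_top_eq dg top tr0); rewrite -(energyE dg).
have f0 i : i != i0 -> (P *m indicator K) i 0 = 0.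
  by apply: (rayleigh_eq dg d_gt0 neg); rewrite clique_rayleigh // -dK.
have g0 i : i != i0 -> (P *m indicator setT) i 0 = 0.
  apply: (rayleigh_eq dg d_gt0 neg).
  rewrite indicator_form indicator_sqnorm cardsT dA average_degreeE //.
  rewrite -(sum_arcs e_sym e_irr); congr (_ %:R).
  by apply: eq_big => [x1|x1 _]; [|apply: eq_bigl => y1]; rewrite inE.
(* Both transformed vectors are supported on the coordinate [i0]; cross-multiplying by these
   coordinates gives a linear relation. *)
pose a := (P *m indicator setT) i0 0; pose b := (P *m indicator K) i0 0.
have w0 : a *: indicator K = b *: indicator setT.
  apply/eqP; rewrite -subr_eq0 -sqnorm_eq0.
  rewrite -(isometry_sqnorm _ (diagonalizes_isometry dg)) sqnorm_eq0.
  apply/eqP/colP => i; rewrite [RHS]mxE.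
  have -> : (P *m (a *: indicator K - b *: indicator setT)) i 0 =
      a * (P *m indicator K) i 0 - b * (P *m indicator setT) i 0.
    by rewrite mulmxBr -!scalemxAr !mxE.
  have [->|ii0] := eqVneq i i0; first by rewrite /a /b mulrC subrr.
  by rewrite f0 // g0 // !mulr0 subrr.
(* At a vertex outside [K] the relation gives [b = 0], so the indicator of [K] would vanish. *)
have KT : K = setT.
  apply/setP => z; rewrite inE; apply: contraNT K0 => zK.
  move/matrixP/(_ (enum_rank z) 0): w0.
  rewrite !mxE enum_rankK (negPf zK) inE mulr0 mulr1 => /esym b0.
  rewrite -cards_eq0 -(pnatr_eq0 algC) -indicator_sqnorm.
  rewrite -(isometry_sqnorm _ (diagonalizes_isometry dg)) sqnorm_eq0.
  apply/eqP/colP => i; rewrite [RHS]mxE.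
  by have [->|/f0] := eqVneq i i0.
move=> x' y'; have [->|xy'] := eqVneq x' y'; first by rewrite e_irr.
have /forall_inP/(_ x') := cK; rewrite KT inE => /(_ isT)/forall_inP/(_ y').
by rewrite inE xy' => /(_ isT).
Qed.

End EnergyBounds.

(** * Domination, matchings and extremal graphs *)

Section DominationAndMatchings.
Variables (T : finType) (e : rel T).
Hypotheses (e_sym : symmetric e) (e_irr : irreflexive e).

Lemma total_domination_attained : no_isolated_vertex e ->
  exists2 S, total_dominating e S & #|S| = total_domination_number e.
Proof.
move=> iso; rewrite /total_domination_number.
elim/big_ind: _ => [|m1 m2 [S1 S1d <-] [S2 S2d <-]|S Sd].
(* The default value [#|T|] is the size of [setT], which dominates since no vertex is isolated. *)
- exists setT; last by rewrite cardsT.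
  apply/forallP => x; have [y exy] := iso x.
  by apply/existsP; exists y; rewrite inE.
- by rewrite /minn; case: ifP => _; [exists S1|exists S2].
- by exists S.
Qed.

Lemma total_domination_leq S :
  total_dominating e S -> (total_domination_number e <= #|S|)%N.
Proof.
move=> Sd; rewrite /total_domination_number.
exact: (bigmin_le_cond #|T| (fun S : {set T} => #|S|) Sd).
Qed.

(* Each vertex [x] of a minimum total dominating set [S] has a private
   neighbour: a vertex whose only neighbour in [S] is [x]. *)
Lemma private_neighbours S :
  total_dominating e S -> #|S| = total_domination_number e ->
  exists r : T -> T, {in S &, forall x y, e x (r y) = (x == y)}.
Proof.
move=> Sd cardS.
have pn y : exists u, y \in S -> forall x, x \in S -> e x u = (x == y).
  have [yS|] := boolP (y \in S); last by exists y.
  (* By minimality some [u] has no neighbour in [S] other than [y]; as [S] dominates [u], that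
     neighbour is [y]. *)
  have : ~~ total_dominating e (S :\ y).
    apply/negP => /total_domination_leq.
    by rewrite -cardS (cardsD1 y S) yS ltnn.
  case/forallPn => u /exists_inPn nu; exists u => _ x xS.
  have [->|xy] := eqVneq x y; last first.
    by rewrite e_sym; apply/negbTE/nu; rewrite !inE xy.
  have /forallP/(_ u)/exists_inP[z zS euz] := Sd.
  have [<-|zy] := eqVneq z y; first by rewrite e_sym.
  by have := nu z; rewrite !inE zy zS euz => /(_ isT).
have [r rP] := fin_all_exists pn.
by exists r => x y xS yS; apply: rP.
Qed.

Lemma induced_matching_attained :
  exists2 M, induced_matching e M & #|M| = induced_matching_number e.
Proof.
have [|M iM maxM] :=
    @eq_bigmax_cond _ [pred M | induced_matching e M] (fun M => #|M|).
  apply/card_gt0P; exists set0; rewrite inE.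
  apply/andP; split; first by rewrite /matching sub0set /trivIset /cover !big_set0 cards0.
  apply/eqP/setP => f; rewrite !inE /cover big_set0 subset0.
  apply/andP => -[/imsetP[p _ ->] /eqP/setP/(_ p.1)].
  by rewrite set21 inE.
by exists M; [rewrite inE in iM | rewrite -maxM].
Qed.

Lemma leq_induced_matching_number M :
  induced_matching e M -> (#|M| <= induced_matching_number e)%N.
Proof. exact: (leq_bigmax_cond (F := fun M : {set {set T}} => #|M|)). Qed.

Lemma card_edge f : f \in edges e -> #|f| = 2%N.
Proof.
case/imsetP => -[x y]; rewrite inE /= => exy ->.
by rewrite cards2; case: eqP exy => // ->; rewrite e_irr.
Qed.

Lemma card_cover_matching M : matching e M -> #|cover M| = (2 * #|M|)%N.
Proof.
case/andP => /subsetP sM /eqP <-.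
by rewrite (eq_bigr (fun=> 2%N)) ?sum_nat_const 1?mulnC // => f /sM /card_edge.
Qed.

(** The partner of [y] is the other end of its edge in [M]. An edge from another covered vertex to
    that partner would lie in [M], which is induced, and edges of [M] sharing a vertex coincide. *)
Lemma induced_matching_partners M : induced_matching e M ->
  exists r : T -> T, {in cover M &, forall x y, e x (r y) = (x == y)}.
Proof.
case/andP => /andP[/subsetP sM triv] /eqP indM.
have pt y : exists u, y \in cover M ->
    forall x, x \in cover M -> e x u = (x == y).
  have [/bigcupP[B BM yB]|] := boolP (y \in cover M); last by exists y.
  have [u eyu defB] : exists2 u, e y u & B = [set y; u].
    have /imsetP[[a b]] := sM B BM; rewrite inE /= => eab defB.
    move: yB; rewrite defB => /set2P[] ->; first by exists b.
    by exists a; [rewrite e_sym | rewrite setUC].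
  have uB : u \in B by rewrite defB set22.
  have uM : u \in cover M by apply/bigcupP; exists B.
  exists u => _ x xM; have [->//|xy] := eqVneq x y.
  apply: contra_neqF xy => exu.
  have xuM : [set x; u] \in M.
    rewrite -indM inE; apply/andP; split.
      by apply/imsetP; exists (x, u); rewrite ?inE.
    by apply/subsetP => z /set2P[]->.
  have xB : x \in B.
    rewrite -(def_pblock triv BM uB) (def_pblock triv xuM) ?set21 //.
    by rewrite set22.
  move: xB; rewrite defB => /set2P[//|xu].
  by rewrite xu e_irr in exu.
have [r rP] := fin_all_exists pt.
by exists r => x y xM yM; apply: rP.
Qed.

End DominationAndMatchings.

(** * Graphs attaining equality *)

Section ExtremalGraphs.
Variables (T : finType) (e : rel T).
Hypotheses (e_sym : symmetric e) (e_irr : irreflexive e) (T0 : (0 < #|T|)%N).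

Lemma edgeless_extremal : edgeless e ->
  energy e = (clique_number e)%:R + average_degree e - 1.
Proof.
move=> noe; have edges0 : #|edges e| = 0%N.
  apply/eqP; rewrite -(eqn_pmul2l (m := 2)) // muln0 -(sum_arcs e_sym e_irr).
  by rewrite big1 // => x _; rewrite big1 // => y _; rewrite (negPf (noe x y)).
have avg0 : average_degree e = 0 by rewrite /average_degree edges0 muln0 mul0r.
have En : energy e = 0.
  have [P [d [i0 [dg _]]]] := spectrum_exists e_sym T0.
  have := diagonalizes_trace_sqr dg; rewrite (adjacency_trace_sqr e_sym e_irr).
  rewrite edges0 muln0 => d0; rewrite (energyE dg) big1 // => i _.
  by apply/eqP; rewrite -sqrf_eq0 (psumr_eq0P _ d0) // => j _; rewrite exprn_ge0.
(* The clique bound itself shows that the clique number is at most one. *)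
rewrite En avg0 addr0; apply/le_anti.
rewrite subr_ge0 ler1n clique_number_gt0 //=.
by have := energy_clique_bound e_sym e_irr T0; rewrite En avg0 addr0.
Qed.

(** With n vertices, A = J - I satisfies A^2 = (n - 2)A + (n - 1)I, so every eigenvalue is -1 or n -
    1. *)
Lemma complete_extremal : (forall x y, e x y = (x != y)) ->
  energy e = (clique_number e)%:R + average_degree e - 1.
Proof.
move=> eK; have cT : clique e setT.
  by apply/forall_inP => x _; apply/forall_inP => y _; rewrite eK implybb.
have n0 : #|T|%:R != 0 :> algC by rewrite pnatr_eq0 -lt0n.
have avg : average_degree e = #|T|%:R - 1.
  apply: (mulIf n0); rewrite average_degreeE // -(sum_arcs e_sym e_irr).
  have -> : (\sum_x \sum_y e x y = \sum_(x in setT) \sum_(y in setT) e x y)%N.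
    apply: eq_big => [x|x _]; first by rewrite inE.
    by apply: eq_bigl => y; rewrite inE.
  by rewrite (clique_form e_irr cT) cardsT natrM -subn1 natrB // mulrC.
have En : energy e = 2 * (#|T|%:R - 1).
  have [P [d [i0 [dg _]]]] := spectrum_exists e_sym T0.
  pose J : 'M[algC]_#|T| := const_mx 1.
  have JJ : J *m J = #|T|%:R *: J.
    apply/matrixP => i j; rewrite !mxE mulr1.
    under eq_bigr do rewrite !mxE mulr1.
    by rewrite sumr_const card_ord.
  have AJ : adjacency e = J - 1%:M.
    apply/matrixP => i j; rewrite !mxE eK (inj_eq enum_val_inj).
    by case: (i == j); rewrite ?subrr ?subr0.
  have AA : adjacency e *m adjacency e =
      (#|T|%:R - 2) *: adjacency e + (#|T|%:R - 1)%:M.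
    rewrite AJ mulmxBl !mulmxBr mulmx1 !mul1mx JJ.
    by apply/matrixP => i j; rewrite !mxE; case: (i == j) => /=; ring.
  (* At -1 and n - 1 the absolute value agrees with a linear function, so the zero trace yields the
     energy without counting multiplicities. *)
  have dn i : #|T|%:R * `|d 0 i| = (#|T|%:R - 2) * d 0 i + 2 * (#|T|%:R - 1).
    have /eqP := diagonalizes_quadratic_relation dg i AA.
    rewrite -subr_eq0 (_ : _ - _ = (d 0 i + 1) * (d 0 i - (#|T|%:R - 1))); last by ring.
    rewrite mulf_eq0 addr_eq0 subr_eq0 => /orP[]/eqP->.
      by rewrite normrN1; ring.
    by rewrite ger0_norm ?subr_ge0 ?ler1n //; ring.
  apply: (mulfI n0); rewrite (energyE dg) mulr_sumr.
  under eq_bigr do rewrite dn.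
  rewrite big_split /= -mulr_sumr (diagonalizes_trace dg) adjacency_trace //.
  by rewrite mulr0 add0r sumr_const card_ord -[LHS]mulr_natl.
have cn : clique_number e = #|T|.
  have leT := leq_clique_number cT; rewrite cardsT in leT.
  apply/eqP; rewrite eqn_leq leT andbT.
  have := energy_clique_bound e_sym e_irr T0; rewrite En avg -(ler_nat algC).
  rewrite (_ : _ - 1 = (clique_number e)%:R + (#|T|%:R - 2)); last by ring.
  rewrite (_ : 2 * _ = #|T|%:R + (#|T|%:R - 2)); last by ring.
  by rewrite lerD2r.
by rewrite En avg cn; ring.
Qed.

(** * Graphs in which every vertex has exactly one neighbour *)

Variable m : T -> T.
Hypothesis mate : forall x y, e x y = (y == m x).

Lemma mateK : involutive m.
Proof. by move=> x; apply/eqP; rewrite eq_sym -mate e_sym mate. Qed.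

Lemma mate_edges : (2 * #|edges e|)%N = #|T|.
Proof.
rewrite -(sum_arcs e_sym e_irr) -sum1_card; apply: eq_bigr => x _.
by rewrite (bigD1 (m x)) //= mate eqxx big1 // => y /negPf; rewrite mate => ->.
Qed.

Lemma mate_average : average_degree e = 1.
Proof. by rewrite /average_degree mate_edges divff // pnatr_eq0 -lt0n. Qed.

(** The adjacency matrix squares to the identity, so all eigenvalues have modulus 1. *)
Lemma mate_energy : energy e = #|T|%:R.
Proof.
have [P [d [i0 [dg _]]]] := spectrum_exists e_sym T0.
have AA : adjacency e *m adjacency e = 0 *: adjacency e + 1%:M.
  rewrite scale0r add0r; apply/matrixP => i j; rewrite !mxE.
  rewrite (bigD1 (enum_rank (m (enum_val i)))) //= big1 ?addr0 => [|k].
    rewrite !mxE !enum_rankK !mate mateK eqxx mul1r (inj_eq enum_val_inj).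
    by rewrite eq_sym.
  rewrite !mxE mate -(inj_eq enum_val_inj) enum_rankK => /negPf->.
  by rewrite mul0r.
rewrite (energyE dg) (eq_bigr (fun=> 1)) => [|i _].
  by rewrite sumr_const card_ord.
have := diagonalizes_quadratic_relation dg i AA.
rewrite mul0r add0r => /eqP; rewrite sqrf_eq1.
by case/orP => /eqP->; rewrite ?normrN normr1.
Qed.

(** Each [x] is the only neighbour of [m x], so it belongs to every total dominating set. *)
Lemma mate_total_domination : total_domination_number e = #|T|.
Proof.
have [|S /forallP Sd <-] := @total_domination_attained _ e.
  by move=> x; exists (m x); rewrite mate.
rewrite -cardsT; congr #|pred_of_set _|; apply/setP => x; rewrite inE.
have /exists_inP[y yS] := Sd (m x).
by rewrite mate mateK => /eqP <-.
Qed.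

Lemma mate_edgeP f : reflect (exists x, f = [set x; m x]) (f \in edges e).
Proof.
apply: (iffP imsetP) => [[[x y]]|[x ->]].
  by rewrite inE /= mate => /eqP-> ->; exists x.
by exists (x, m x); rewrite ?inE /= ?mate.
Qed.

(** The set of all edges is itself an induced matching, and no matching covers more than [#|T|]
    vertices. *)
Lemma mate_induced_matching : (2 * induced_matching_number e)%N = #|T|.
Proof.
apply/eqP; rewrite eqn_leq; apply/andP; split.
  have [M iM <-] := induced_matching_attained e.
  have /andP[mM _] := iM.
  by rewrite -(card_cover_matching e_irr mM) max_card.
rewrite -mate_edges leq_mul2l /=; apply: leq_induced_matching_number.
apply/andP; split; last first.
  apply/eqP/setP => f; rewrite inE; apply/andb_idr => fe.
  exact: bigcup_sup.
rewrite /matching subxx /=; apply/trivIsetP => f g /mate_edgeP[x ->] /mate_edgeP[y ->].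
apply: contraNT; rewrite -setI_eq0 => /set0Pn[z /setIP[/set2P zx /set2P zy]].
have -> : [set x; m x] = [set z; m z].
  by case: zx => ->; rewrite ?mateK // setUC.
by case: zy => ->; rewrite ?mateK // setUC.
Qed.

End ExtremalGraphs.

(** * The adjacency matrix of a path *)

Section PathMatrix.

Definition path_mx k : 'M[algC]_k :=
  \matrix_(i, j) ((i.+1 == j) || (j.+1 == i))%:R.

Lemma path_mx_row_sum k (i : 'I_k) :
  (\sum_(j < k) ((i.+1 == j) || (j.+1 == i)) <= 2)%N.
Proof.
have le1 (f : nat -> nat) c : injective f -> (\sum_(j < k) (f j == c) <= 1)%N.
  move=> f_inj; rewrite -big_mkcond sum1_card; apply/card_le1_eqP => a b.
  move=> /eqP fa /eqP fb; apply/val_inj/f_inj.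
  exact: (etrans fb (esym fa)).
apply: leq_trans (_ : \sum_(j < k) (j == i.+1 :> nat) + \sum_(j < k) (j.+1 == i) <= _)%N.
  rewrite -big_split; apply: leq_sum => j _ /=.
  by rewrite eq_sym; case: eqP; case: eqP.
by apply: (@leq_add _ _ 1 1); [apply: (le1 id) | apply: (le1 succn) => a b []].
Qed.

(** A product is at most half the sum of the two squares, and rows and columns of [path_mx k] sum to
    at most 2. *)
Lemma path_form_bound k (u w : 'cV[algC]_k) :
  `|(u^t* *m path_mx k *m w) 0 0| <= sqnorm u + sqnorm w.
Proof.
pose p (i j : 'I_k) := (i.+1 == j) || (j.+1 == i).
have pC i j : p i j = p j i by rewrite /p orbC.
have -> : (u^t* *m path_mx k *m w) 0 0 =
    \sum_i \sum_j (u i 0)^* * (p i j)%:R * w j 0.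
  rewrite -mulmxA mxE; apply: eq_bigr => i _; rewrite !mxE mulr_sumr.
  by apply: eq_bigr => j _; rewrite mxE mulrA.
pose half : algC := 2^-1.
have half_ge0 : 0 <= half by rewrite invr_ge0.
have half2 : half * 2 = 1 by rewrite mulVf // pnatr_eq0.
apply: (@le_trans _ _ (\sum_i \sum_j ((p i j)%:R * (half * `|u i 0| ^+ 2)
    + (p i j)%:R * (half * `|w j 0| ^+ 2)))).
  apply: le_trans (ler_norm_sum _ _ _) _; apply: ler_sum => i _.
  apply: le_trans (ler_norm_sum _ _ _) _; apply: ler_sum => j _.
  rewrite !normrM norm_conjC normr_nat -mulrDr mulrAC mulrC.
  rewrite ler_wpM2l // -mulrDr -[leLHS]mul1r -half2 -mulrA ler_wpM2l //.
  rewrite -subr_ge0 (_ : _ - _ = (`|u i 0| - `|w j 0|) ^+ 2); last by ring.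
  by rewrite real_exprn_even_ge0 // rpredB // normr_real.
have row (v : 'cV[algC]_k) :
    \sum_i \sum_j (p i j)%:R * (half * `|v i 0| ^+ 2) <= sqnorm v.
  apply: ler_sum => i _; rewrite -mulr_suml -natr_sum mulrA ler_piMl //.
    by rewrite exprn_ge0.
  by rewrite -[leRHS]half2 mulrC ler_wpM2l // ler_nat path_mx_row_sum.
under eq_bigr do rewrite big_split.
rewrite big_split; apply: lerD => /=; first exact: row.
rewrite exchange_big /=; apply: le_trans (row w); apply: ler_sum => i _.
by apply: ler_sum => j _; rewrite pC.
Qed.

(** Integral entries reduce orthogonality of the explicit witnesses to a finite computation. *)
Lemma scaled_int_isometric k (Z : 'M[int]_k) (c : nat) : (0 < c)%N ->
  Z^T *m Z = ((c ^ 2)%:R)%:M ->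
  isometric ((c%:R : algC)^-1 *: map_mx intr Z).
Proof.
move=> c0 ZZ; have cn0 : c%:R != 0 :> algC by rewrite pnatr_eq0 -lt0n.
rewrite /isometric trmxCZ -scalemxAl -scalemxAr scalerA.
have -> : (map_mx intr Z)^t* = map_mx intr Z^T :> 'M[algC]_k.
  by apply/matrixP => i j; rewrite !mxE; apply/CrealP/realz.
rewrite -map_mxM ZZ map_scalar_mx scale_scalar_mx /= rmorph_nat.
have -> : ((c%:R : algC)^-1)^* = c%:R^-1 by apply/CrealP; rewrite realV realn.
by congr _%:M; rewrite natrX; field.
Qed.

(* Up to the factor [1/5], a rotation between the two colour classes. *)
Definition witness4 : 'M[int]_4 := \matrix_(i, j)
  (nth 0 (nth [::] [:: [:: 0; 4; 0; - 3%:Z]; [:: 4; 0; 3; 0];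
                       [:: 0; 3; 0; 4]; [:: - 3%:Z; 0; 4; 0]] i) j).

(* Up to the factor [1/9], a pair of orthonormal vectors joining the colour
   classes [{1, 3}] and [{0, 2, 4}], completed to an involution. *)
Definition witness5 : 'M[int]_5 := \matrix_(i, j)
  (nth 0 (nth [::] [:: [:: 4; 6; - 2%:Z; - 3%:Z; 4]; [:: 6; 0; 6; 0; - 3%:Z];
                       [:: - 2%:Z; 6; 1; 6; - 2%:Z]; [:: - 3%:Z; 0; 6; 0; 6];
                       [:: 4; - 3%:Z; - 2%:Z; 6; 4]] i) j).

Lemma witness4_sqr : witness4^T *m witness4 = ((5 ^ 2)%:R)%:M.
Proof.
apply/matrixP => i j; rewrite !mxE !big_ord_recl big_ord0 !mxE.
by case: i => -[|[|[|[|//]]]] ?; case: j => -[|[|[|[|//]]]] ?.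
Qed.

Lemma witness5_sqr : witness5^T *m witness5 = ((9 ^ 2)%:R)%:M.
Proof.
apply/matrixP => i j; rewrite !mxE !big_ord_recl big_ord0 !mxE.
by case: i => -[|[|[|[|[|//]]]]] ?; case: j => -[|[|[|[|[|//]]]]] ?.
Qed.

Lemma path_mx2_sqr : path_mx 2 *m path_mx 2 = 1%:M.
Proof.
apply/matrixP => i j; rewrite !mxE !big_ord_recl big_ord0 !mxE.
by case: i => -[|[|//]] ?; case: j => -[|[|//]] ?;
  rewrite /= ?mulr0 ?mul0r ?mulr1 ?addr0 ?add0r.
Qed.

(** A further diagonal block [path_mx 2], its own inverse, gains trace 2; the edge joining the two
    pieces of the path meets only zero blocks of [Q']. *)
Lemma path_mx_witness_step k (Q : 'M[algC]_k) : isometric Q ->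
  exists2 Q' : 'M_(k + 2), isometric Q' &
    \tr (path_mx (k + 2) *m Q') = \tr (path_mx k *m Q) + 2.
Proof.
move=> iQ; exists (block_mx Q 0 0 (path_mx 2)).
  rewrite /isometric tr_block_mx map_block_mx !trmx0 !map_mx0 mulmx_block.
  have -> : (path_mx 2)^t* = path_mx 2.
    by apply/matrixP => i j; rewrite !mxE conjC_nat orbC.
  rewrite iQ path_mx2_sqr !mulmx0 !mul0mx !addr0 add0r.
  by rewrite -scalar_mx_block.
rewrite -[path_mx (k + 2)]submxK mulmx_block mxtrace_block !mulmx0 addr0 add0r.
have -> : ulsubmx (path_mx (k + 2)) = path_mx k.
  by apply/matrixP => i j; rewrite !mxE.
have -> : drsubmx (path_mx (k + 2)) = path_mx 2.
  by apply/matrixP => i j; rewrite !mxE /= -!addnS !eqn_add2l.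
by rewrite path_mx2_sqr mxtrace1.
Qed.

(** Induction by twos from lengths 4 and 5; at lengths 2 and 3 the largest possible traces, 2 and
    the square root of 8, leave no excess. *)
Lemma path_mx_witness k : (4 <= k)%N ->
  exists (Q : 'M[algC]_k) (c : algC),
    [/\ isometric Q, 0 < c & \tr (path_mx k *m Q) = k%:R + c].
Proof.
have step l : (exists (Q : 'M[algC]_l) (c : algC),
    [/\ isometric Q, 0 < c & \tr (path_mx l *m Q) = l%:R + c]) ->
  exists (Q : 'M[algC]_l.+2) (c : algC),
    [/\ isometric Q, 0 < c & \tr (path_mx l.+2 *m Q) = l.+2%:R + c].
  case=> Q [c [iQ c0 trQ]]; rewrite -addn2.
  have [Q' iQ' trQ'] := path_mx_witness_step iQ.
  by exists Q', c; split=> //; rewrite trQ' trQ natrD addrAC.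
have base4 : exists (Q : 'M[algC]_4) (c : algC),
    [/\ isometric Q, 0 < c & \tr (path_mx 4 *m Q) = 4%:R + c].
  (* The three edges carry the entries 4, 3, 4, so the trace is 22/5 = 4 + 2/5. *)
  exists ((5%:R)^-1 *: map_mx intr witness4), (2 / 5); split.
  - exact: scaled_int_isometric witness4_sqr.
  - by rewrite divr_gt0.
  rewrite /mxtrace !big_ord_recl big_ord0 !mxE !big_ord_recl !big_ord0 !mxE /=.
  by field.
have base5 : exists (Q : 'M[algC]_5) (c : algC),
    [/\ isometric Q, 0 < c & \tr (path_mx 5 *m Q) = 5%:R + c].
  (* Each of the four edges carries the entry 6, so the trace is 48/9 = 5 + 1/3. *)
  exists ((9%:R)^-1 *: map_mx intr witness5), (1 / 3); split.
  - exact: scaled_int_isometric witness5_sqr.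
  - by rewrite divr_gt0.
  rewrite /mxtrace !big_ord_recl big_ord0 !mxE !big_ord_recl !big_ord0 !mxE /=.
  by field.
elim/ltn_ind: k => -[|[|[|[|[|[|k]]]]]] // IH _.
by apply: step; apply: IH.
Qed.

End PathMatrix.

(** * Complete graphs and perfect matchings up to isomorphism *)

Section Isomorphisms.
Variables (T : finType) (e : rel T).
Hypotheses (e_sym : symmetric e) (e_irr : irreflexive e).

Lemma is_completeP : is_complete e <-> forall x y, e x y = (x != y).
Proof.
split=> [[f f_bij fe] x y|eK].
  by rewrite -fe /complete /= (inj_eq (bij_inj f_bij)).
exists enum_rank; first exact: enum_rank_bij.
by move=> x y; rewrite /complete /= (inj_eq enum_rank_inj) eK.
Qed.

Lemma perfect_matching_mate : is_perfect_matching e ->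
  exists m : T -> T, forall x y, e x y = (y == m x).
Proof.
case=> _ [f [g fK gK] fe].
(* [rev_ord] exchanges the two elements of ['I_2], giving the other end in the same copy. *)
exists (fun x => g ((f x).1, rev_ord (f x).2)) => x y.
rewrite -fe /copies /complete /= -(inj_eq (can_inj fK)) gK.
case: (f x) (f y) => [a b] [a' b'] /=; rewrite xpair_eqE eq_sym.
congr (_ && _); rewrite -!val_eqE /=.
by case: b => -[|[|//]] ?; case: b' => -[|[|//]] ?.
Qed.

(** A vertex is sent to the index of its edge and a bit telling whether it precedes its mate in the
    enumeration of [T]. *)
Lemma mate_perfect_matching (m : T -> T) :
  (0 < #|T|)%N -> (forall x y, e x y = (y == m x)) -> is_perfect_matching e.
Proof.
move=> T0 mate; have mK := mateK e_sym mate.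
have cardE := mate_edges e_sym e_irr mate.
have cardE2 : #|edges e| = #|T|./2 by rewrite -cardE mul2n doubleK.
split; first by rewrite -cardE mul2n odd_double.
have m_neq x : m x != x.
  by apply: contraFneq (e_irr x) => mx; rewrite mate mx.
pose block x := [set x; m x].
have blockE x : block x \in edges e by apply/(mate_edgeP mate); exists x.
have /card_gt0P[x0 _] := T0.
pose b x := (enum_rank x < enum_rank (m x))%N.
have bm x : b (m x) = ~~ b x.
  rewrite /b mK -leqNgt ltn_neqAle; case: eqVneq => // /val_inj/enum_rank_inj mx.
  by have := m_neq x; rewrite mx eqxx.
have block_eq x y : (block x == block y) = (y == x) || (y == m x).
  apply/eqP/orP => [xy|[]/eqP->//]; last by rewrite /block mK setUC.
  have : y \in block x by rewrite xy set21.
  by case/set2P => <-; [left | right].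
pose f x := (cast_ord cardE2 (enum_rank_in (blockE x0) (block x)), inord (b x) : 'I_2).
have f1 x y : ((f x).1 == (f y).1) = (block x == block y).
  rewrite /= (inj_eq (@cast_ord_inj _ _ _)); apply/eqP/eqP => [|->//].
  exact: enum_rank_in_inj.
have f2 x y : ((f x).2 == (f y).2) = (b x == b y).
  by rewrite /= -val_eqE /= !inordK //; case: (b x); case: (b y).
exists f; last first.
  move=> x y; rewrite /copies /complete [LHS]/=.
  rewrite [_ == _]f1 [_ != _](congr1 negb (f2 x y)) mate block_eq.
  have [->|yx] := eqVneq y x; first by rewrite eqxx eq_sym (negPf (m_neq x)).
  by case: eqVneq => //= ->; rewrite bm; case: (b x).
apply: inj_card_bij; last first.
  by rewrite card_prod !card_ord -cardE2 mulnC cardE.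
move=> x y fxy; have := f1 x y; have := f2 x y; rewrite fxy !eqxx block_eq.
move=> /esym/eqP bxy /esym/orP[]/eqP // yx.
by move: bxy; rewrite yx bm; case: (b x).
Qed.

End Isomorphisms.

(** * Distances and geodesics *)

Section Distance.
Variables (T : finType) (e : rel T).
Hypothesis e_conn : connected e.

Lemma distance_leq x y p : path e x p -> last x p = y ->
  (distance e x y <= size p)%N.
Proof.
move=> ep lp; rewrite /distance; have [small|large] := ltnP (size p) #|T|.
  apply: (bigmin_le_cond #|T| (fun k : 'I_#|T| => k : nat)
            (j := Ordinal small)).
  by apply/existsP; exists (in_tuple p); rewrite ep lp eqxx.
exact: leq_trans (bigmin_le_id _ #|T| _ (fun k : 'I_#|T| => k : nat)) large.
Qed.

Lemma shortest_path x y :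
  exists p, [/\ path e x p, last x p = y & size p = distance e x y].
Proof.
have : distance e x y = #|T| \/
    exists p, [/\ path e x p, last x p = y & size p = distance e x y].
  rewrite /distance; elim/big_ind: _ => [|m1 m2 IH1 IH2|k /existsP[p]].
  - by left.
  - by rewrite /minn; case: ifP.
  - by case/andP=> ep /eqP lp; right; exists p; rewrite size_tuple.
(* The default value [#|T|] is excluded: a path without repetition has fewer than [#|T|] steps. *)
case=> // dT; have /connectP[p ep lp] := e_conn x y.
move: lp; case/shortenP: ep => p' ep' up' _ lp.
have := distance_leq ep' (esym lp); rewrite dT => le_p'.
by have := max_card (mem (x :: p')); rewrite (card_uniqP up') /= ltnNge le_p'.
Qed.

Lemma distance_step x y z : e y z -> (distance e x z <= (distance e x y).+1)%N.
Proof.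
move=> eyz; have [p [ep lp <-]] := shortest_path x y.
rewrite -(size_rcons p z); apply: distance_leq; last exact: last_rcons.
by rewrite rcons_path ep lp.
Qed.

Lemma distance_refl x : distance e x x = 0%N.
Proof. by apply/eqP; rewrite -leqn0; apply: (@distance_leq _ _ [::]). Qed.

(* Along a shortest path the distance to its origin grows by one at each step,
   whereas adjacent vertices have distances differing by at most one. *)
Lemma induced_path x y : symmetric e -> irreflexive e ->
  exists v : nat -> T,
    let D := distance e x y in
    {in [pred i | i <= D]%N &, injective v} /\
    {in [pred i | i <= D]%N &, forall i j,
      e (v i) (v j) = (i.+1 == j) || (j.+1 == i)}.
Proof.
move=> e_sym e_irr; have [p [ep lp sp]] := shortest_path x y.
exists (nth x (x :: p)) => /=; set v := nth _ _; set D := distance _ _ _.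
have step i : (i < D)%N -> e (v i) (v i.+1).
  by rewrite /D -sp => ip; have /(pathP x)/(_ i ip) := ep.
have le_up i : (i <= D)%N -> (distance e x (v i) <= i)%N.
  elim: i => [_|i IH iD]; first by rewrite distance_refl.
  by apply: leq_trans (distance_step x (step _ iD)) _; rewrite ltnS IH // ltnW.
(* Going back from [y], each step lowers the distance from [x] by at most one. *)
have le_down i : (i <= D)%N -> (D <= distance e x (v (D - i)%N) + i)%N.
  elim: i => [_|i IH iD].
    by rewrite subn0 addn0 /v /D -sp nth_last /= lp sp.
  apply: leq_trans (IH (ltnW iD)) _; rewrite addnS -addSn leq_add2r.
  have -> : (D - i)%N = (D - i.+1).+1 by rewrite -subSn // subSS.
  by apply/distance_step/step; rewrite ltn_subrL (leq_trans _ iD).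
have vE i : (i <= D)%N -> distance e x (v i) = i.
  move=> iD; apply/eqP; rewrite eqn_leq le_up //=.
  have := le_down _ (leq_subr i D); rewrite subKn //.
  by rewrite -{1}(subnKC iD) leq_add2r.
split=> i j; rewrite !inE => iD jD.
  by move=> vij; rewrite -(vE i iD) vij vE.
apply/idP/orP => [vij|[]/eqP ij]; last 2 first.
- by rewrite -ij; apply: step; rewrite ij.
- by rewrite e_sym -ij; apply: step; rewrite ij.
have := distance_step x vij; rewrite e_sym in vij.
have := distance_step x vij; rewrite !vE // => ij ji.
have ij0 : i != j by apply: contraTneq vij => ->; rewrite e_irr.
by move: ij ji ij0; lia.
Qed.

Lemma diameter_attained : (0 < #|T|)%N -> exists x y, distance e x y = diameter e.
Proof.
move=> T0; have [|[x y] dxy] := @bigop.eq_bigmax _ (fun p : T * T => distance e p.1 p.2).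
  by rewrite card_prod muln_gt0 T0.
by exists x, y.
Qed.

End Distance.

(** * The diameter bound *)

Section DiameterBound.
Variables (T : finType) (e : rel T).
Hypotheses (e_sym : symmetric e) (e_irr : irreflexive e) (T0 : (0 < #|T|)%N).
Hypothesis e_conn : connected e.

(* With [Q] from [path_mx_witness], the induced path on [D + 1] vertices
   contributes more than [D + 1], of which deflation costs at most [2]. *)
Lemma energy_long_diameter : (3 <= diameter e)%N ->
  (diameter e)%:R + average_degree e - 1 < energy e.
Proof.
have [x [y dxy]] := diameter_attained e T0.
have [v [v_inj ve]] := induced_path e_conn x y e_sym e_irr.
rewrite dxy in v_inj ve; set D := diameter e in v_inj ve * => D3.
have [P [d [i0 [dg top]]]] := spectrum_exists e_sym T0.
pose f (s : 'I_D.+1) : 'I_#|T| := enum_rank (v s).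
have f_inj : injective f.
  move=> i j /enum_rank_inj vij; apply/val_inj/v_inj => //.
    by rewrite inE -ltnS ltn_ord.
  by rewrite inE -ltnS ltn_ord.
have [Q [c [iQ c0 trQ]]] := path_mx_witness (D3 : 4 <= D.+1)%N.
have iP := diagonalizes_isometry dg.
have iJ := selection_isometric f_inj.
(* Twisting only the right isometry by [Q] makes the compressed matrix [path_mx D.+1 *m Q]. *)
have [] := @deflated_bound _ _ _ (P *m selection_mx f)
  (P *m (selection_mx f *m Q)) d i0 isT (isometric_mul iP iJ)
  (isometric_mul iP (isometric_mul iJ iQ)).
rewrite (diagonalizes_compression dg) mulmxA selection_compression.
have -> : mxsub f f (adjacency e) = path_mx D.+1.
  by apply/matrixP => i j; rewrite !mxE !enum_rankK ve // inE -ltnS ltn_ord.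
have ge0 : 0 <= D.+1%:R + c by rewrite addr_ge0 // ltW.
move=> z z1; rewrite trQ (ger0_norm ge0).
(* The deflation term is at most [sqnorm z + sqnorm (Q *m z)], which is 2. *)
have := path_form_bound z (Q *m z).
rewrite (isometry_sqnorm _ iQ) z1 !mulmxA => le2 leD.
have lt : D%:R - 1 < \sum_(i | i != i0) `|d 0 i|.
  have := le_trans leD (lerD le2 (lexx _)).
  rewrite -lerBlDl; apply: lt_le_trans.
  by rewrite -natr1 (_ : _ - (1 + 1) = D%:R - 1 + c) ?ltrDl //; ring.
rewrite (energy_split e_irr dg top) addrAC [ltRHS]addrC.
exact: ltr_leD lt (top_ge_average e_sym e_irr dg top).
Qed.

End DiameterBound.

(** An edge exists, so the clique number is at least 2 and the clique bound applies. Equality would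
    make the graph complete with diameter equal to its clique number, yet a complete graph has
    diameter at most 1. *)
Lemma energy_short_diameter (T : finType) (e : rel T) :
  symmetric e -> irreflexive e -> (2 <= #|T|)%N -> connected e ->
  (diameter e <= 2)%N -> (diameter e)%:R + average_degree e - 1 < energy e.
Proof.
move=> e_sym e_irr T2 e_conn D2; have T0 : (0 < #|T|)%N by apply: leq_trans T2.
have [x [y exy]] : exists x y, e x y.
  have /card_gt1P[x [y [_ _ xy]]] := T2.
  have /connectP[[|z p] /=] := e_conn x y.
    by move=> _ yx; rewrite yx eqxx in xy.
  by case/andP => exz _ _; exists x, z.
have w2 : (2 <= clique_number e)%N := clique_number_ge2 e_sym e_irr exy.
have bound := energy_clique_bound e_sym e_irr T0.
have Dw : (diameter e)%:R + average_degree e - 1 <=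
    (clique_number e)%:R + average_degree e - 1.
  by rewrite !lerD2r ler_nat (leq_trans D2).
rewrite lt_neqAle (le_trans Dw bound) andbT; apply/eqP => En.
have Ew : energy e = (clique_number e)%:R + average_degree e - 1.
  by apply/le_anti; rewrite bound andbT -En.
have D_eq : diameter e = clique_number e.
  by move: En; rewrite Ew => /addIr/addIr/eqP; rewrite eqr_nat => /eqP.
have [eK|/(_ x y)] := energy_clique_eq e_sym e_irr T0 Ew; last by rewrite exy.
suff : (diameter e <= 1)%N by rewrite D_eq leqNgt w2.
apply/bigmax_leqP => -[a b] _ /=; have [->|ab] := eqVneq a b.
  by rewrite distance_refl.
by apply: (@distance_leq _ _ _ _ [:: b]); rewrite //= eK ab.
Qed.

Theorem corollary9p2 (T : finType) (e : rel T)
    (e_sym : symmetric e) (e_irr : irreflexive e) (n_ge5 : (5 <= #|T|)%N) :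
  (energy e >= (clique_number e)%:R + average_degree e - 1 /\
   (energy e = (clique_number e)%:R + average_degree e - 1 <->
      is_complete e \/ edgeless e)) /\
  (energy e >= 2 * (induced_matching_number e)%:R + average_degree e - 1 /\
   (energy e = 2 * (induced_matching_number e)%:R + average_degree e - 1 <->
      is_perfect_matching e)) /\
  (no_isolated_vertex e ->
   energy e >= (total_domination_number e)%:R + average_degree e - 1 /\
   (energy e = (total_domination_number e)%:R + average_degree e - 1 <->
      is_perfect_matching e)) /\
  (connected e ->
   energy e > (diameter e)%:R + average_degree e - 1).
Proof.
have T0 : (0 < #|T|)%N by apply: leq_trans n_ge5.
have complete_or_edgeless :
    energy e = (clique_number e)%:R + average_degree e - 1 <->
    is_complete e \/ edgeless e.
  split=> [/(energy_clique_eq e_sym e_irr T0)[/is_completeP|]|[/is_completeP|]].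
  - by left.
  - by right.
  - exact: complete_extremal.
  - exact: edgeless_extremal.
split; first by split=> //; apply: energy_clique_bound.
split.
  have [M iM cardM] := induced_matching_attained e.
  have [r rM] := induced_matching_partners e_sym e_irr iM.
  have cardC : (2 * induced_matching_number e)%N = #|cover M|.
    by rewrite -cardM (card_cover_matching e_irr) //; case/andP: iM.
  rewrite -natrM; split; first by rewrite cardC; exact: energy_pairing_bound rM.
  split=> [|/perfect_matching_mate[m mate]].
    rewrite cardC => /(energy_pairing_eq e_sym e_irr T0 rM)[m].
    exact: mate_perfect_matching.
  rewrite (mate_induced_matching e_sym e_irr mate).
  by rewrite (mate_energy e_sym T0 mate) (mate_average e_sym e_irr T0 mate) addrK.
split=> [no_iso|e_conn].
  have [S Sd cardS] := total_domination_attained no_iso.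
  have [r rS] := private_neighbours e_sym Sd cardS.
  split; first by rewrite -cardS; exact: energy_pairing_bound rS.
  split=> [|/perfect_matching_mate[m mate]].
    rewrite -cardS => /(energy_pairing_eq e_sym e_irr T0 rS)[m].
    exact: mate_perfect_matching.
  rewrite (mate_total_domination e_sym mate).
  by rewrite (mate_energy e_sym T0 mate) (mate_average e_sym e_irr T0 mate) addrK.
have [D2|D3] := leqP (diameter e) 2; last exact: energy_long_diameter.
by apply: energy_short_diameter => //; apply: leq_trans n_ge5.
Qed.
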